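(* For any integer $n\geq 3$, the poset $(\mathrm{DO}(M_n),\preceq)$ of all derivations on $M_n$, with bottom $\mathbf{0}_{M_n}$ and top $\mathrm{Id}_{M_n}$, is a lattice.
   Context: For $n\geq 3$, $M_n=\{0,b_1,b_2,\dots,b_{n-2},1\}$ is the $n$-element diamond type lattice with bottom $0$, top $1$, and $n-2$ pairwise incomparable elements $b_1,\dots,b_{n-2}$ strictly between $0$ and $1$ (so $b_i\wedge b_j=0$ and $b_i\vee b_j=1$ for $i\neq j$). A derivation on a bounded lattice $L$ is a map $d:L\to L$ with $d(x\wedge y)=(d(x)\wedge y)\vee(x\wedge d(y))$ for all $x,y\in L$; $\mathrm{DO}(L)$ is the set of all derivations on $L$. For $d,d'\in\mathrm{DO}(L)$, write $d\preceq d'$ if $d(x)\leq d'(x)$ for all $x\in L$. $\mathbf{0}_L$ denotes the constant map with value $0$ and $\mathrm{Id}_L$ the identity map on $L$. *)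

(* Defs.v *)
From HB Require Import structures.
From mathcomp Require Import all_boot all_order.
From mathcomp Require Import boolp.

Set Implicit Arguments.
Unset Strict Implicit.
Unset Printing Implicit Defensive.

Import Order.TTheory.

Local Open Scope order_scope.

Section LatticePoset.
Context {disp : Order.disp_t} {P : porderType disp}.

Definition is_glb (x y m : P) : Prop :=
  [/\ m <= x, m <= y & forall z : P, z <= x -> z <= y -> z <= m].

Definition is_lub (x y j : P) : Prop :=
  [/\ x <= j, y <= j & forall z : P, x <= z -> y <= z -> j <= z].

End LatticePoset.

Definition is_lattice {disp : Order.disp_t} (P : porderType disp) : Prop :=
  forall x y : P, (exists m : P, is_glb x y m) /\ (exists j : P, is_lub x y j).

Definition derivation {disp : Order.disp_t} {L : tbLatticeType disp}
    (d : L -> L) : Prop :=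
  forall x y : L, d (x `&` y) = (d x `&` y) `|` (x `&` d y).

Record DO {disp : Order.disp_t} (L : tbLatticeType disp) := MkDO {
  DO_fun :> L -> L;
  DO_funP : `[< derivation DO_fun >]
}.

Fact DO_display : Order.disp_t.
Proof. exact: Order.Disp tt tt. Qed.

(* The order on [DO L] is inherited from the pointwise order on functions;
   see [DO_leP]. *)
HB.instance Definition _ {disp : Order.disp_t} (L : tbLatticeType disp) :=
  [isSub for @DO_fun disp L].
HB.instance Definition _ {disp : Order.disp_t} (L : tbLatticeType disp) :=
  [Choice of DO L by <:].
HB.instance Definition _ {disp : Order.disp_t} (L : tbLatticeType disp) :=
  [SubChoice_isSubPOrder of DO L by <: with DO_display].

Section DOTheory.
Context {disp : Order.disp_t} (L : tbLatticeType disp).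

Lemma DO_leP (d d' : DO L) :
  reflect (forall x : L, d x <= d' x) (d <= d').
Proof. exact: lefP. Qed.

Lemma derivation_zero : derivation (fun _ : L => \bot).
Proof. by move=> x y; rewrite meet0x meetx0 joinxx. Qed.

Lemma derivation_id : derivation (fun x : L => x).
Proof. by move=> x y; rewrite joinxx. Qed.

Definition DO_zero : DO L := MkDO (asboolT derivation_zero).

Definition DO_id : DO L := MkDO (asboolT derivation_id).

End DOTheory.

(* For [n >= 3], [M n] has exactly [n] elements ([card_M]): the subtraction
   [n - 2] is truncated, so smaller [n] all give the two-element chain. *)
Variant M (n : nat) : Type := Mbot | Mtop | Mmid of 'I_(n - 2).
Arguments Mbot {n}.
Arguments Mtop {n}.

Section Diamond.
Context {n : nat}.
Implicit Types x y z : M n.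

Definition M_code x : option (option 'I_(n - 2)) :=
  match x with
  | Mbot => None
  | Mtop => Some None
  | Mmid i => Some (Some i)
  end.

Definition M_decode (c : option (option 'I_(n - 2))) : M n :=
  match c with
  | None => Mbot
  | Some None => Mtop
  | Some (Some i) => Mmid i
  end.

Lemma M_codeK : cancel M_code M_decode.
Proof. by case. Qed.

Lemma M_decodeK : cancel M_decode M_code.
Proof. by case=> [[]|]. Qed.

HB.instance Definition _ := Finite.copy (M n) (can_type M_codeK).

Lemma card_M : (3 <= n)%N -> #|{: M n}| = n.
Proof.
move=> n3; rewrite (bij_eq_card (Bijective M_codeK M_decodeK)).
by rewrite !card_option card_ord -addn2 subnK // ltnW.
Qed.

Definition M_le : rel (M n) := fun x y =>
  match x, y with
  | Mbot, _ => true
  | _, Mtop => true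
  | Mmid i, Mmid j => i == j
  | _, _ => false
  end.

Definition M_meet x y : M n :=
  match x, y with
  | Mbot, _ => Mbot
  | _, Mbot => Mbot
  | Mtop, _ => y
  | _, Mtop => x
  | Mmid i, Mmid j => if i == j then x else Mbot
  end.

Definition M_join x y : M n :=
  match x, y with
  | Mbot, _ => y
  | _, Mbot => x
  | Mtop, _ => Mtop
  | _, Mtop => Mtop
  | Mmid i, Mmid j => if i == j then x else Mtop
  end.

Lemma M_le_refl : reflexive M_le.
Proof. by case=> //= i. Qed.

Lemma M_le_anti : antisymmetric M_le.
Proof. by case=> [||i] [||j] //= /andP[/eqP->]. Qed.

Lemma M_le_trans : transitive M_le.
Proof. by case=> [||i] [||j] [||k] //= /eqP-> /eqP->. Qed.

Lemma M_leI x y z : M_le x (M_meet y z) = M_le x y && M_le x z.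
Proof.
case: x y z => [||i] [||j] [||k] //=; rewrite ?andbT ?andbF //.
  by case: ifP.
have [->|jk] := eqVneq j k => /=; first by rewrite andbb.
by have [->|//] := eqVneq i j; rewrite (negPf jk).
Qed.

Lemma M_leU x y z : M_le (M_join x y) z = M_le x z && M_le y z.
Proof.
case: x y z => [||i] [||j] [||k] //=; rewrite ?andbT ?andbF //.
- by case: ifP.
- by case: ifP.
have [->|ij] := eqVneq i j => /=; first by rewrite andbb.
by have [<-|//] := eqVneq i k; rewrite eq_sym (negPf ij).
Qed.

Lemma M_le0x x : M_le Mbot x.
Proof. by []. Qed.

Lemma M_lex1 x : M_le x Mtop.
Proof. by case: x. Qed.

End Diamond.

Fact M_display : Order.disp_t.
Proof. exact: Order.Disp tt tt. Qed.

HB.instance Definition _ (n : nat) := Order.Le_isPOrder.Build M_display (M n)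
  M_le_refl M_le_anti M_le_trans.
HB.instance Definition _ (n : nat) :=
  Order.POrder_MeetJoin_isLattice.Build M_display (M n) M_leI M_leU.
HB.instance Definition _ (n : nat) :=
  Order.hasBottom.Build M_display (M n) M_le0x.
HB.instance Definition _ (n : nat) :=
  Order.hasTop.Build M_display (M n) M_lex1.

(* Main.v *)
Require Import Defs.
From mathcomp Require Import all_boot all_order.
From mathcomp Require Import boolp.
Import Order.TTheory.
Local Open Scope order_scope.

(** A derivation [d] on a bounded lattice is contracting, [d x <= x] (put
    [y = x]), and satisfies [x `&` d \top <= d x] (put [y = \top]).  On the
    diamond [M n] these two conditions are also sufficient: they give the
    derivation identity when [x = y] or when one of [x], [y] is [\bot] or [\top],
    and if [x], [y] are distinct atoms, contraction makes both sides [\bot].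

    In any bounded lattice where the two conditions suffice, the derivations
    form a lattice.  The pointwise meet of two derivations satisfies both
    conditions, hence is their meet.  The pointwise join need not, because
    [x `&` (d \top `|` d' \top)] can exceed [d x `|` d' x]; but every upper bound
    [e] of [d] and [d'] has [e x >= x `&` e \top >= x `&` (d \top `|` d' \top)],
    so joining this element to the pointwise join yields the least upper
    bound. *)

Section Derivations.
Context {disp : Order.disp_t} {L : tbLatticeType disp}.

(** Contracting maps whose value at [x] is bounded below by the meet of [x] with
    the value at the top: the two conditions that every derivation satisfies. *)
Definition top_bounded (d : L -> L) : Prop :=
  (forall x, d x <= x) /\ (forall x, x `&` d \top <= d x).

Lemma derivation_top_bounded (d : L -> L) : derivation d -> top_bounded d.
Proof.
move=> dd; split=> x.
  by have := dd x x; rewrite meetxx (meetC x) joinxx => ->; apply: leIr.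
by have := dd x \top; rewrite !meetx1 => ->; apply: leUr.
Qed.

Lemma top_bounded_DO (d : DO L) : top_bounded d.
Proof. exact/derivation_top_bounded/asboolP/DO_funP. Qed.

Lemma DO_zero_le (d : DO L) : DO_zero L <= d.
Proof. by apply/DO_leP => x; apply: le0x. Qed.

Lemma DO_le_id (d : DO L) : d <= DO_id L.
Proof. by apply/DO_leP => x; case: (top_bounded_DO d) => + _; apply. Qed.

Lemma top_bounded_meet (d d' : L -> L) :
  top_bounded d -> top_bounded d' -> top_bounded (fun x => d x `&` d' x).
Proof.
move=> [dx dt] [_ dt']; split=> x; first exact: leIxl.
rewrite lexI (le_trans _ (dt x)) ?(le_trans _ (dt' x)) //.
- by rewrite leI2 // leIr.
- by rewrite leI2 // leIl.
Qed.

Lemma top_bounded_join (d d' : L -> L) :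
  top_bounded d -> top_bounded d' ->
  top_bounded (fun x => (d x `|` d' x) `|` (x `&` (d \top `|` d' \top))).
Proof.
move=> [dx _] [dx' _]; split=> x; first by rewrite !leUx dx dx' leIl.
by rewrite meet1x joinxx leUr.
Qed.

Lemma is_lattice_DO :
  (forall d : L -> L, top_bounded d -> derivation d) -> is_lattice (DO L).
Proof.
move=> tbP d d'; have tb := top_bounded_DO d; have tb' := top_bounded_DO d'.
split.
  exists (MkDO (asboolT (tbP _ (top_bounded_meet _ _ tb tb')))).
  split=> [||e /DO_leP ed /DO_leP ed']; apply/DO_leP => x /=.
  - exact: leIl.
  - exact: leIr.
  - by rewrite lexI ed ed'.
exists (MkDO (asboolT (tbP _ (top_bounded_join _ _ tb tb')))).
split=> [||e /DO_leP de /DO_leP de']; apply/DO_leP => x /=.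
- by rewrite -joinA leUl.
- by rewrite joinAC leUr.
rewrite !leUx de de' /=; have [_ et] := top_bounded_DO e.
by rewrite (le_trans _ (et x)) // leI2 // leUx de de'.
Qed.

End Derivations.

Lemma M_meet_mid_neq {n : nat} (i j : 'I_(n - 2)) :
  i != j -> Mmid i `&` Mmid j = \bot :> M n.
Proof. by move=> ij; rewrite -[LHS]/(M_meet _ _) /= (negPf ij). Qed.

Lemma top_bounded_derivation_M {n : nat} (d : M n -> M n) :
  top_bounded d -> derivation d.
Proof.
move=> [dx dt].
have d0 : d \bot = \bot by apply/eqP; rewrite -lex0 dx.
have d1 y : (y `&` d \top) `|` d y = d y by apply/join_r/dt.
move=> [||i] y.
- by rewrite -[Mbot]/(\bot : M n) meet0x d0 !meet0x joinxx.
- by rewrite -[Mtop]/(\top : M n) !meet1x (meetC (d _)) d1.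
case: y => [||j].
- by rewrite -[Mbot]/(\bot : M n) meetx0 d0 !meetx0 joinxx.
- by rewrite -[Mtop]/(\top : M n) !meetx1 joinC d1.
have [->|ij] := eqVneq i j.
  by rewrite meetxx (meetC (Mmid j)) joinxx; apply/esym/meet_l/dx.
rewrite M_meet_mid_neq // d0; apply/esym/eqP.
by rewrite -lex0 leUx -(M_meet_mid_neq _ _ ij) !leI2.
Qed.

Theorem proposition4p19 (n : nat) (hn : (3 <= n)%N) :
  [/\ forall d : DO (M n), DO_zero (M n) <= d,
      forall d : DO (M n), d <= DO_id (M n)
    & is_lattice (DO (M n))].
Proof.
split; [exact: DO_zero_le | exact: DO_le_id |].
exact: is_lattice_DO top_bounded_derivation_M.
Qed.
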